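(* Let $\xi\sim F(\mu,\rho)$ be a Feller random measure with parameters $\mu$ and $\rho$. Then the random variable $(f*\xi)(t)$ is infinitely divisible for all $t\ge0$ and all continuous $f:[0,\infty)\to\mathbb{R}$ with $f(0)=0$.
   Context: $(f*\kappa)(t)=\int_{[0,t]}f(t-s)\,\kappa(ds)$. Feller random measure: let $\mu$ be a measure on $[0,\infty)$ finite on bounded sets, and $\rho$ a probability measure on $[0,\infty)$ with $\rho(\{0\})=0$ whose Laplace transform is $\hat\rho=1/(1-\log\hat\nu)$ for some infinitely divisible probability measure $\nu$ on $[0,\infty)$. $F(\mu,\rho)$ is the law of the locally finite random measure $\xi$ on $[0,\infty)$ uniquely characterized by $\mathbb{E}[e^{(f*\xi)(t)}]=e^{(h[f]*\mu)(t)}$, $t\ge0$, for all continuous $f$ with $f(0)=0$, $|f|\le1/2$, where $h[f]$ is the unique locally bounded solution of $h=(f+\frac12h^2)*\rho$. (Existence and uniqueness of this law, for every such pair $\mu,\rho$, may be taken as known.) *)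

(* Defs.v *)
From HB Require Import structures.
From mathcomp Require Import all_boot all_order all_algebra.
From mathcomp Require Import all_classical all_reals all_analysis.
From mathcomp Require Import measurable_realfun.

Set Implicit Arguments.
Unset Strict Implicit.
Unset Printing Implicit Defensive.
Import Order.TTheory GRing.Theory Num.Theory.
Import numFieldNormedType.Exports.
Local Open Scope classical_set_scope.
Local Open Scope ring_scope.

(* Measures on the half-line [0, +oo[ are represented by the Borel measures on
   R that give mass 0 to ]-oo, 0[; functions on [0, +oo[ by functions R -> R
   of which only the values on [0, +oo[ are ever used. *)
Definition half_line_measure (R : realType) (m : set R -> \bar R) : Prop :=
  m `]-oo, 0[%classic = 0%E.

Definition finite_on_bounded (R : realType) (m : set R -> \bar R) : Prop :=
  forall A : set R, measurable A -> bounded_set A -> (m A < +oo)%E.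

(* (f * kappa)(t) *)
Definition fconv (R : realType) (f : R -> R) (kappa : {measure set R -> \bar R})
    (t : R) : R :=
  \int[kappa]_(s in `[0, t]) f (t - s).

Definition laplace (R : realType) (m : {measure set R -> \bar R}) (l : R) : R :=
  \int[m]_(s in `[0, +oo[) expR (- (l * s)).

Section convolution_of_probabilities.
Context (R : realType).

Definition add_pair (z : R * R) : R := z.1 + z.2.

Let measurable_add_pair : measurable_fun [set: R * R] add_pair.
Proof. by apply: measurable_funD. Qed.

HB.instance Definition _ :=
  isMeasurableFun.Build _ _ _ _ add_pair measurable_add_pair.

Definition pconv (P Q : probability R R) : probability R R :=
  distribution (P \x Q)%E add_pair.

Fixpoint pconv_pow (n : nat) (P : probability R R) : probability R R :=
  if n is k.+1 then pconv P (pconv_pow k P) else \d_(0 : R).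

End convolution_of_probabilities.

Definition infinitely_divisible (R : realType) (m : set R -> \bar R) : Prop :=
  forall n : nat, (0 < n)%N -> exists P : probability R R,
    forall A : set R, measurable A -> m A = pconv_pow n P A.

Definition infinitely_divisible_rv (R : realType) (d : measure_display)
    (Omega : measurableType d) (P : probability Omega R) (X : Omega -> R) :
    Prop :=
  measurable_fun [set: Omega] X /\ infinitely_divisible (pushforward P X).

(* The standing assumptions on the parameters mu and rho. *)
Definition feller_mu (R : realType) (mu : {measure set R -> \bar R}) : Prop :=
  half_line_measure mu /\ finite_on_bounded mu.

Definition feller_rho (R : realType) (rho : probability R R) : Prop :=
  [/\ half_line_measure rho,
      rho [set 0] = 0%E &
      exists nu : probability R R,
        [/\ half_line_measure nu,
            infinitely_divisible nu &
            forall l : R, 0 <= l ->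
              laplace rho l = 1 / (1 - ln (laplace nu l))]].

Definition locally_bounded (R : realType) (h : R -> R) : Prop :=
  forall t : R, exists M : R, forall s : R, 0 <= s <= t -> `|h s| <= M.

(* h is a locally bounded solution of h = (f + h^2 / 2) * rho; measurability
   is implicit in the fact that the convolutions make sense. *)
Definition feller_solution (R : realType) (rho : probability R R)
    (f h : R -> R) : Prop :=
  [/\ measurable_fun (`[0, +oo[%classic : set R) h,
      locally_bounded h &
      forall t : R, 0 <= t ->
        h t = fconv (fun s => f s + 2^-1 * h s ^+ 2) rho t].

(* h = h[f], the unique locally bounded solution on [0, +oo[ *)
Definition feller_h (R : realType) (rho : probability R R)
    (f h : R -> R) : Prop :=
  feller_solution rho f h /\
  forall h' : R -> R, feller_solution rho f h' ->
    forall t : R, 0 <= t -> h' t = h t.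

(* A random measure is a kernel from the probability space; it is required to
   be carried by [0, +oo[ and locally finite for every outcome. *)
Definition feller_random_measure (R : realType) (d : measure_display)
    (Omega : measurableType d) (P : probability Omega R)
    (xi : R.-ker Omega ~> R)
    (mu : {measure set R -> \bar R}) (rho : probability R R) : Prop :=
  [/\ forall w, half_line_measure (xi w),
      forall w, finite_on_bounded (xi w) &
      forall f : R -> R, {within `[0, +oo[, continuous f} -> f 0 = 0 ->
        (forall s : R, 0 <= s -> `|f s| <= 2^-1) ->
        exists h : R -> R, feller_h rho f h /\
          forall t : R, 0 <= t ->
            ('E_P[fun w => expR (fconv f (xi w) t)]
               = (expR (fconv h mu t))%:E)%E].

(* The law of a random measure lives on the space of measures, with the
   sigma-algebra generated by the evaluations m |-> m B, B Borel. *)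
Definition evaluation_preimages (R : realType) :
    set (set {measure set R -> \bar R}) :=
  [set A | exists B : set R, exists C : set (\bar R),
     [/\ measurable B, measurable C & A = [set m : {measure set R -> \bar R} | C (m B)]]].

Definition same_law (R : realType)
    (d1 : measure_display) (Omega1 : measurableType d1)
    (P1 : probability Omega1 R) (xi1 : R.-ker Omega1 ~> R)
    (d2 : measure_display) (Omega2 : measurableType d2)
    (P2 : probability Omega2 R) (xi2 : R.-ker Omega2 ~> R) : Prop :=
  forall A : set {measure set R -> \bar R}, <<s @evaluation_preimages R >> A ->
    P1 [set w | A (xi1 w)] = P2 [set w | A (xi2 w)].

(* Existence and uniqueness of the law F(mu, rho), known facts. *)
Definition feller_law_exists (R : realType) : Prop :=
  forall (mu : {measure set R -> \bar R}) (rho : probability R R),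
    feller_mu mu -> feller_rho rho ->
    exists (d : measure_display) (Omega : measurableType d)
      (P : probability Omega R) (xi : R.-ker Omega ~> R),
      feller_random_measure P xi mu rho.

Definition feller_law_unique (R : realType) : Prop :=
  forall (mu : {measure set R -> \bar R}) (rho : probability R R),
    feller_mu mu -> feller_rho rho ->
    forall (d1 : measure_display) (Omega1 : measurableType d1)
      (P1 : probability Omega1 R) (xi1 : R.-ker Omega1 ~> R)
      (d2 : measure_display) (Omega2 : measurableType d2)
      (P2 : probability Omega2 R) (xi2 : R.-ker Omega2 ~> R),
      feller_random_measure P1 xi1 mu rho ->
      feller_random_measure P2 xi2 mu rho ->
      same_law P1 xi1 P2 xi2.

(* Main.v *)
Require Import Defs.
From HB Require Import structures.
From mathcomp Require Import all_boot all_order all_algebra.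
From mathcomp Require Import all_classical all_reals all_analysis.
From mathcomp Require Import measurable_realfun.

Set Implicit Arguments.
Unset Strict Implicit.
Unset Printing Implicit Defensive.
Import Order.TTheory GRing.Theory Num.Theory.
Import numFieldNormedType.Exports.
Local Open Scope classical_set_scope.
Local Open Scope ring_scope.

(** The map [mu |-> F(mu, rho)] turns addition of measures into addition of
    independent random measures.  Indeed [h[f]] depends on [rho] and [f] only,
    so if [xi1] and [xi2] are independent with laws [F(mu1, rho)] and
    [F(mu2, rho)], the exponential moment of [f * (xi1 + xi2)] factors into
    [exp ((h[f] * mu1) t) * exp ((h[f] * mu2) t)], which is the value
    [exp ((h[f] * (mu1 + mu2)) t)] that characterizes [F(mu1 + mu2, rho)]
    ([feller_random_measure_add]).

    Given [n > 0], take [xi0] with law [F(mu / n, rho)].  The sum of [n]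
    independent copies of [xi0] then has law [F(mu, rho)], and its convolution
    with [f] at [t] is a sum of [n] independent copies of [(f * xi0)(t)], so
    its law is an [n]-th convolution power ([feller_convolution_power]).
    Since the law [F(mu, rho)] is unique, this sum and [xi] have the same law
    as random measures.  The functional [m |-> (f * m)(t)] is measurable for
    the sigma-algebra generated by the evaluations, so the two real random
    variables have the same law as well ([same_law_fconv]).

    The bound [1/2] on [f] in the characterization of [F(mu, rho)] concerns the
    test functions that identify the law of the random measure; the function
    [f] of the conclusion enters through the measurable functional. *)

(** * The convolution [(f * m)(t)] as a function of [f] and [m] *)

Section fconv.
Context (R : realType).
Implicit Types (f h : R -> R) (t : R) (m : {measure set R -> \bar R}).

Lemma measurable_fun_conv_arg f t :
  measurable_fun (`[0, +oo[%classic : set R) f ->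
  measurable_fun (`[0, t]%classic : set R) (fun s => f (t - s)).
Proof.
move=> mf.
have img : [set t - s | s in `[0, t]%classic] `<=` `[0, +oo[%classic.
  move=> _ [s /= + <-]; rewrite !in_itv/= => /andP[_ st].
  by rewrite andbT subr_ge0.
have mB : measurable_fun (`[0, t]%classic : set R) (fun s => t - s).
  exact: measurable_funB.
exact: (measurable_comp _ img mf mB).
Qed.

(** The integral of a nonnegative function is measurable in the measure, and
    the positive and negative parts of the integrand are treated separately.
    The family [l] is arbitrary so that the lemma applies both to a kernel and
    to the identity of the space of all measures. *)
Lemma measurable_fconv d (X : measurableType d)
    (l : X -> {measure set R -> \bar R}) f t :
  (forall B, measurable B -> measurable_fun [set: X] (l ^~ B)) ->
  measurable_fun (`[0, +oo[%classic : set R) f ->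
  measurable_fun [set: X] (fun x => fconv f (l x) t).
Proof.
move=> ml mf; rewrite /fconv /Rintegral.
apply: (@measurableT_comp _ _ _ _ _ _ (@fine R)) => //.
have mfe : measurable_fun `[0, t]%classic (fun s => (f (t - s))%:E).
  by apply/measurable_EFinP; exact: measurable_fun_conv_arg.
under eq_fun do rewrite integralE.
by apply: emeasurable_funB; under eq_fun do rewrite integral_mkcond;
  apply: measurable_fun_integral_kernel => //;
  try (by move=> s; apply: erestrict_ge0);
  apply/(measurable_restrictT _ _).1 => //;
  [exact: measurable_funepos|exact: measurable_funeneg].
Qed.

Lemma integrable_conv_arg f t m : finite_on_bounded m ->
  measurable_fun (`[0, +oo[%classic : set R) f -> locally_bounded f ->
  m.-integrable `[0, t]%classic (EFin \o (fun s => f (t - s))).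
Proof.
move=> fm mf bf; apply: measurable_bounded_integrable => //.
- by apply: fm => //; apply: compact_bounded; exact: segment_compact.
- exact: measurable_fun_conv_arg.
- have [M HM] := bf t; exists M; split; first exact: num_real.
  move=> x Mx s /=; rewrite in_itv/= => /andP[s0 st].
  apply: (le_trans _ (ltW Mx)); apply: HM.
  by rewrite subr_ge0 st gerBl.
Qed.

Lemma fconv_measure_add f t m1 m2 :
  finite_on_bounded m1 -> finite_on_bounded m2 ->
  measurable_fun (`[0, +oo[%classic : set R) f -> locally_bounded f ->
  fconv f (measure_add m1 m2) t = fconv f m1 t + fconv f m2 t.
Proof.
move=> fm1 fm2 mf bf.
have i1 := integrable_conv_arg t fm1 mf bf.
have i2 := integrable_conv_arg t fm2 mf bf.
rewrite /fconv /Rintegral integral_measure_add//.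
by rewrite fineD//; exact: integrable_fin_num.
Qed.

Lemma eq_fconv f h t m : (forall s, 0 <= s -> f s = h s) ->
  fconv f m t = fconv h m t.
Proof.
move=> fh; apply: eq_Rintegral => s; rewrite inE/= in_itv/= => /andP[_ st].
by apply: fh; rewrite subr_ge0.
Qed.

Lemma eq_measure_fconv f t m1 m2 :
  (forall A, measurable A -> m1 A = m2 A) -> fconv f m1 t = fconv f m2 t.
Proof.
by move=> e; congr fine; apply: eq_measure_integral => A mA _; exact: e.
Qed.

Lemma within_continuous_measurable f :
  {within `[0, +oo[, continuous f} ->
  measurable_fun (`[0, +oo[%classic : set R) f.
Proof. by move=> cf; apply: subspace_continuous_measurable_fun. Qed.

Lemma within_continuous_locally_bounded f :
  {within `[0, +oo[, continuous f} -> locally_bounded f.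
Proof.
move=> cf t.
have ct : {within `[0, t], continuous f}.
  apply: continuous_subspaceW cf => s /=.
  by rewrite !in_itv/= andbT => /andP[].
have /compact_bounded[M [_ HM]] :=
  continuous_compact ct (@segment_compact R 0 t).
exists (M + 1) => s st; apply: (HM (M + 1)); first by rewrite ltrDl.
by exists s => //=; rewrite in_itv.
Qed.

End fconv.

(** * The law of [(f * xi)(t)] is determined by the law of [xi] *)

Section evaluation.
Context (R : realType).

(** An alias of the type of measures, on which the pointed structure required
    of a measurable type can be declared. *)
Definition measure_space : Type := {measure set R -> \bar R}.

HB.instance Definition _ := gen_eqMixin measure_space.
HB.instance Definition _ := gen_choiceMixin measure_space.
HB.instance Definition _ := isPointed.Build measure_space mzero.

Lemma evaluation_fconv f t (A : set R) :
  measurable_fun (`[0, +oo[%classic : set R) f -> measurable A ->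
  <<s @evaluation_preimages R >> [set m | A (fconv f m t)].
Proof.
move=> mf mA.
have /(_ measurableT A mA) : measurable_fun
    [set: g_sigma_algebraType (@evaluation_preimages R : set (set measure_space))]
    (fun m => fconv f m t).
  apply: measurable_fconv => // B mB _ C mC; rewrite setTI.
  by apply: sub_gen_smallest; exists B, C; split.
by rewrite setTI.
Qed.

Lemma same_law_fconv d1 (Omega1 : measurableType d1)
    (P1 : probability Omega1 R) (xi1 : R.-ker Omega1 ~> R)
    d2 (Omega2 : measurableType d2)
    (P2 : probability Omega2 R) (xi2 : R.-ker Omega2 ~> R) f t A :
  same_law P1 xi1 P2 xi2 ->
  measurable_fun (`[0, +oo[%classic : set R) f -> measurable A ->
  P1 [set w | A (fconv f (xi1 w) t)] = P2 [set w | A (fconv f (xi2 w) t)].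
Proof.
by move=> sl mf mA; exact: (sl _ (evaluation_fconv t mf mA)).
Qed.

End evaluation.

(** * Sums of independent random variables *)

Section independent_sum.
Context (R : realType) d1 d2 (O1 : measurableType d1) (O2 : measurableType d2)
  (P1 : probability O1 R) (P2 : probability O2 R).

Lemma expectation_exp_add (X : O1 -> R) (Y : O2 -> R) :
  measurable_fun setT X -> measurable_fun setT Y ->
  ('E_(P1 \x P2)[fun w => expR (X w.1 + Y w.2)] =
   'E_P1[fun w => expR (X w)] * 'E_P2[fun w => expR (Y w)])%E.
Proof.
move=> mX mY; rewrite !unlock fubini_tonelli1//=; last first.
  apply/measurable_EFinP; apply: measurableT_comp => //.
  by apply: measurable_funD; exact: measurableT_comp.
have E (x : O1) : (fubini_F P2 (fun z : O1 * O2 => (expR (X z.1 + Y z.2))%:E) x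
   = \int[P2]_y (expR (Y y))%:E * (expR (X x))%:E)%E.
  rewrite /fubini_F/= muleC -ge0_integralZl//.
  - by apply: eq_integral => y _; rewrite expRD EFinM.
  - by apply/measurable_EFinP; exact: measurableT_comp.
under eq_integral do rewrite E.
rewrite ge0_integralZl//; first by rewrite muleC.
- by apply/measurable_EFinP; exact: measurableT_comp.
- by apply: integral_ge0 => y _; rewrite lee_fin expR_ge0.
Qed.

Lemma law_add (X : {mfun O1 >-> R}) (Y : {mfun O2 >-> R}) (A : set R) :
  measurable A ->
  (P1 \x P2)%E [set w | A (X w.1 + Y w.2)] =
  pconv (distribution P1 X) (distribution P2 Y) A.
Proof.
move=> mA.
have mAA : measurable (@Defs.add_pair R @^-1` A) by exact: measurable_funPTI.
rewrite [RHS]/= /product_measure1/= ge0_integral_distribution//.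
exact: measurable_fun_xsection.
Qed.

End independent_sum.

(** Measures that agree on measurable sets need not be equal as functions on
    all sets, hence this congruence. *)
Lemma eq_pconv (R : realType) (P1 P2 Q1 Q2 : probability R R) (A : set R) :
  (forall B, measurable B -> P1 B = P2 B) ->
  (forall B, measurable B -> Q1 B = Q2 B) ->
  measurable A -> pconv P1 Q1 A = pconv P2 Q2 A.
Proof.
move=> eP eQ mA.
have mAA : measurable (@Defs.add_pair R @^-1` A) by exact: measurable_funPTI.
rewrite /pconv /distribution /pushforward /= /product_measure1/=.
transitivity (\int[P1]_x (Q2 \o xsection (@Defs.add_pair R @^-1` A)) x)%E.
  by apply: eq_integral => x _ /=; apply: eQ; exact: measurable_xsection.
by apply: eq_measure_integral => B mB _; exact: eP.
Qed.

(** * Additivity of Feller random measures in [mu] *)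

Section feller.
Context (R : realType).

Section sum_kernel.
Context d1 d2 (O1 : measurableType d1) (O2 : measurableType d2)
  (xi1 : R.-ker O1 ~> R) (xi2 : R.-ker O2 ~> R).

Definition sum_kernel (w : O1 * O2) : {measure set R -> \bar R} :=
  measure_add (xi1 w.1) (xi2 w.2).

Let measurable_sum_kernel B : measurable B ->
  measurable_fun [set: O1 * O2] (sum_kernel ^~ B).
Proof.
move=> mB.
have -> : sum_kernel ^~ B = (fun w => xi1 w.1 B + xi2 w.2 B)%E.
  by apply/funext => w; rewrite -measure_addE.
apply: emeasurable_funD.
- exact: (measurableT_comp (measurable_kernel xi1 B mB) measurable_fst).
- exact: (measurableT_comp (measurable_kernel xi2 B mB) measurable_snd).
Qed.

HB.instance Definition _ :=
  isKernel.Build _ _ _ _ R sum_kernel measurable_sum_kernel.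

End sum_kernel.

Lemma half_line_measure_add (m1 m2 : {measure set R -> \bar R}) :
  half_line_measure m1 -> half_line_measure m2 ->
  half_line_measure (measure_add m1 m2).
Proof.
by rewrite /half_line_measure => h1 h2; rewrite measure_addE h1 h2 adde0.
Qed.

Lemma finite_on_bounded_add (m1 m2 : {measure set R -> \bar R}) :
  finite_on_bounded m1 -> finite_on_bounded m2 ->
  finite_on_bounded (measure_add m1 m2).
Proof.
by move=> h1 h2 A mA bA; rewrite measure_addE lte_add_pinfty ?h1 ?h2.
Qed.

Lemma feller_mu_add (m1 m2 : {measure set R -> \bar R}) :
  feller_mu m1 -> feller_mu m2 -> feller_mu (measure_add m1 m2).
Proof.
move=> [h1 f1] [h2 f2]; split.
- exact: half_line_measure_add.
- exact: finite_on_bounded_add.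
Qed.

Lemma feller_mu0 : feller_mu (mzero : {measure set R -> \bar R}).
Proof. by split => // A mA bA; rewrite /mzero ltry. Qed.

(** The solution [h] supplied with [xi1] also serves for [xi2], because the
    equation that defines it does not involve the measure [mu]. *)
Lemma feller_random_measure_add d1 d2
    (O1 : measurableType d1) (O2 : measurableType d2)
    (P1 : probability O1 R) (P2 : probability O2 R)
    (xi1 : R.-ker O1 ~> R) (xi2 : R.-ker O2 ~> R)
    (mu1 mu2 : {measure set R -> \bar R}) (rho : probability R R) :
  feller_mu mu1 -> feller_mu mu2 ->
  feller_random_measure P1 xi1 mu1 rho ->
  feller_random_measure P2 xi2 mu2 rho ->
  feller_random_measure (P1 \x P2)%E (sum_kernel xi1 xi2)
    (measure_add mu1 mu2) rho.
Proof.
move=> [_ fmu1] [_ fmu2] [hl1 fin1 E1] [hl2 fin2 E2]; split.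
- by move=> w; exact: half_line_measure_add.
- by move=> w; exact: finite_on_bounded_add.
move=> f cf f0 f2.
have [h [hh Eh]] := E1 f cf f0 f2.
have [h' [hh' Eh']] := E2 f cf f0 f2.
exists h; split=> // t t0.
have mf := within_continuous_measurable cf.
have bf := within_continuous_locally_bounded cf.
have [mh bh _] := hh.1.
have -> : (fun w => expR (fconv f (sum_kernel xi1 xi2 w) t)) =
    (fun w => expR (fconv f (xi1 w.1) t + fconv f (xi2 w.2) t)).
  by apply/funext => w; rewrite fconv_measure_add.
rewrite (expectation_exp_add P1 P2 (X := fun w => fconv f (xi1 w) t)
  (Y := fun w => fconv f (xi2 w) t)).
- rewrite Eh// Eh'// -EFinM -expRD fconv_measure_add//.
  by rewrite (@eq_fconv _ h' h)//; exact: hh.2 hh'.1.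
- by apply: measurable_fconv => // B; exact: measurable_kernel.
- by apply: measurable_fconv => // B; exact: measurable_kernel.
Qed.

Lemma fconv_mzero (f : R -> R) t : fconv f mzero t = 0.
Proof. by rewrite /fconv /Rintegral integral_measure_zero. Qed.

(** The neutral element of the addition of random measures.  The existence of the solution
    [h[f]], which depends on [rho] and [f] only, is inherited from [xi]. *)
Lemma feller_random_measure0 d (Omega : measurableType d)
    (P : probability Omega R) (xi : R.-ker Omega ~> R)
    (mu : {measure set R -> \bar R}) (rho : probability R R) :
  feller_random_measure P xi mu rho ->
  feller_random_measure P (@kzero _ _ Omega R R) mzero rho.
Proof.
move=> [_ _ E]; split; try by move=> w; have [] := feller_mu0.
move=> f cf f0 f2; have [h [hh _]] := E f cf f0 f2.
exists h; split=> // t t0; rewrite fconv_mzero expR0.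
have -> : (fun w => expR (fconv f (@kzero _ _ Omega R R w) t)) = cst 1.
  by apply/funext => w; rewrite fconv_mzero expR0.
exact: expectation_cst.
Qed.

Lemma eq_feller_random_measure d (Omega : measurableType d)
    (P : probability Omega R) (xi : R.-ker Omega ~> R)
    (mu mu' : {measure set R -> \bar R}) (rho : probability R R) :
  (forall A, measurable A -> mu A = mu' A) ->
  feller_random_measure P xi mu rho -> feller_random_measure P xi mu' rho.
Proof.
move=> e [hl fin E]; split=> // f cf f0 f2.
have [h [hh Eh]] := E f cf f0 f2; exists h; split=> // t t0.
by rewrite Eh// (eq_measure_fconv h t e).
Qed.

Fixpoint nmeasure n (m : {measure set R -> \bar R}) :
    {measure set R -> \bar R} :=
  if n is k.+1 then measure_add m (nmeasure k m) else mzero.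

Lemma nmeasureE n m A : nmeasure n m A = (m A *+ n)%E.
Proof.
elim: n => [//|n IH].
by rewrite -[LHS]/(measure_add m (nmeasure n m) A) measure_addE IH muleS.
Qed.

Lemma feller_mu_nmeasure n m : feller_mu m -> feller_mu (nmeasure n m).
Proof.
move=> hm; elim: n => [|n IH] /=; first exact: feller_mu0.
exact: feller_mu_add.
Qed.

(** The random measure [xi'] is the sum of [n] independent copies of [xi],
    built by adding one factor [Omega] to the product space at each step. *)
Lemma feller_convolution_power d (Omega : measurableType d)
    (P : probability Omega R) (xi : R.-ker Omega ~> R)
    (mu : {measure set R -> \bar R}) (rho : probability R R)
    (f : R -> R) t (X : {mfun Omega >-> R}) n :
  feller_mu mu -> feller_random_measure P xi mu rho ->
  {within `[0, +oo[, continuous f} ->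
  (forall w, X w = fconv f (xi w) t) ->
  exists d' (Omega' : measurableType d') (P' : probability Omega' R)
    (xi' : R.-ker Omega' ~> R),
    feller_random_measure P' xi' (nmeasure n mu) rho /\
    forall A, measurable A ->
      P' [set w | A (fconv f (xi' w) t)] = pconv_pow n (distribution P X) A.
Proof.
move=> hmu hxi cf XE.
have mf := within_continuous_measurable cf.
have bf := within_continuous_locally_bounded cf.
elim: n => [|n IH]; last first.
  have [d2 [T2 [P' [xi' [hxi' lawE]]]]] := IH.
  have mY : measurable_fun setT (fun w => fconv f (xi' w) t).
    by apply: measurable_fconv => // B; exact: measurable_kernel.
  pose Y : {mfun T2 >-> R} :=
    HB.pack (fun w => fconv f (xi' w) t) (isMeasurableFun.Build _ _ _ _ _ mY).
  exists (d, d2).-prod%mdisp, (Omega * T2)%type, (P \x P')%E,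
    (sum_kernel xi xi'); split.
    by apply: feller_random_measure_add => //; exact: feller_mu_nmeasure.
  move=> A mA.
  transitivity (pconv (distribution P X) (distribution P' Y) A); last first.
    exact: eq_pconv.
  rewrite -law_add//; congr ((P \x P')%E _).
  apply: eq_set => w /=; rewrite XE fconv_measure_add//.
  - by case: hxi.
  - by case: hxi'.
exists d, Omega, P, (@kzero _ _ Omega R R); split.
  exact: feller_random_measure0 hxi.
move=> A mA /=; under eq_set do rewrite fconv_mzero.
rewrite diracE; case: (boolP (0 \in A)).
  rewrite inE => A0; rewrite -(probability_setT P); congr (P _).
  by apply/seteqP; split.
rewrite notin_setE => A0; transitivity (P set0); last by rewrite measure0.
by congr (P _); apply/seteqP; split.
Qed.

End feller.

(** * Infinite divisibility *)

Theorem corollary3p10 (R : realType)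
    (law_exists : feller_law_exists R) (law_unique : feller_law_unique R)
    (mu : {measure set R -> \bar R}) (rho : probability R R)
    (hmu : feller_mu mu) (hrho : feller_rho rho)
    (d : measure_display) (Omega : measurableType d)
    (P : probability Omega R) (xi : R.-ker Omega ~> R)
    (hxi : feller_random_measure P xi mu rho)
    (t : R) (ht : 0 <= t)
    (f : R -> R) (hf : {within `[0, +oo[, continuous f}) (hf0 : f 0 = 0) :
  infinitely_divisible_rv P (fun w => fconv f (xi w) t).
Proof.
have mf := within_continuous_measurable hf.
split; first by apply: measurable_fconv => // B; exact: measurable_kernel.
move=> n n0.
have n0R : 0 < n%:R^-1 :> R by rewrite invr_gt0 ltr0n.
(* [mun] is [mu / n], so that [nmeasure n mun] is [mu] on measurable sets. *)
pose mun : {measure set R -> \bar R} := mscale (NngNum (ltW n0R)) mu.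
have hmun : feller_mu mun.
  case: hmu => hl fin; split.
    by rewrite /half_line_measure /mun /= /mscale hl mule0.
  move=> A mA bA; rewrite /mun /= /mscale /=.
  by rewrite lte_mul_pinfty ?lee_fin ?ltW ?fin.
have [d0 [T0 [P0 [xi0 hxi0]]]] := law_exists mun rho hmun hrho.
have mX : measurable_fun setT (fun w => fconv f (xi0 w) t).
  by apply: measurable_fconv => // B; exact: measurable_kernel.
pose X : {mfun T0 >-> R} :=
  HB.pack (fun w => fconv f (xi0 w) t) (isMeasurableFun.Build _ _ _ _ _ mX).
exists (distribution P0 X) => A mA.
have [d2 [T2 [P' [xi' [hxi' lawE]]]]] :=
  @feller_convolution_power R d0 T0 P0 xi0 mun rho f t X n hmun hxi0 hf
    (fun=> erefl).
rewrite -lawE//; apply: (@same_law_fconv _ _ _ P xi _ _ P' xi') => //.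
apply: (law_unique mu rho) => //; apply: eq_feller_random_measure hxi' => B mB.
rewrite nmeasureE /mun /= /mscale /= -mule_natl muleA -EFinM divff ?mul1e//.
by rewrite pnatr_eq0 -lt0n.
Qed.
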